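(* Suppose $G$ is a finitely generated infinite group which is not of bounded exponent and which is not virtually nilpotent. If there are $c,\delta>0$ such that all nonempty finite subsets $A$ of $G$ with $\langle A\rangle$ not virtually nilpotent satisfy $|A^3|\ge c|A|^{1+\delta}$, then $\delta\le 1$.
   Context: ''Not of bounded exponent'' means that either $G$ has elements of infinite order or there is no upper bound to the orders of elements of $G$. $A^3=\{a_1a_2a_3 : a_1,a_2,a_3\in A\}$, and $\langle A\rangle$ is the subgroup generated by $A$. *)

(* Defs.v *)
From mathcomp Require Import all_boot all_order all_algebra finmap.
From mathcomp Require Import boolp classical_sets functions cardinality.

Set Implicit Arguments.
Unset Strict Implicit.
Unset Printing Implicit Defensive.

Local Open Scope fset_scope.
Local Open Scope classical_set_scope.
Local Open Scope group_scope.

(* A possibly infinite group is a groupType G (from monoid.v); its subgroups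
   are sets of elements, so that no decidability of membership is required. *)

Definition subgroup (G : groupType) (H : set G) : Prop :=
  group_closed (mem H).

Definition generated (G : groupType) (A : set G) : set G :=
  smallest (@subgroup G) A.

Definition finitely_generated (G : groupType) : Prop :=
  exists S : {fset G}, generated [set` S] = [set: G].

Definition commutator_subgroup (G : groupType) (H K : set G) : set G :=
  generated [set [~ x, y] | x in H & y in K].

Fixpoint lower_central (G : groupType) (H : set G) (n : nat) : set G :=
  if n is m.+1 then commutator_subgroup (lower_central H m) H else H.

Definition nilpotent_subgroup (G : groupType) (H : set G) : Prop :=
  exists n : nat, lower_central H n = [set 1].

Definition left_cosets (G : groupType) (K H : set G) : set (set G) :=
  [set [set x * k | k in K] | x in H].

Definition virtually_nilpotent (G : groupType) (H : set G) : Prop :=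
  exists K : set G, [/\ subgroup K, K `<=` H, finite_set (left_cosets K H)
    & nilpotent_subgroup K].

Definition infinite_order (G : groupType) (g : G) : Prop :=
  forall n : nat, (0 < n)%N -> g ^+ n <> 1.

Definition has_order (G : groupType) (g : G) (n : nat) : Prop :=
  [/\ (0 < n)%N, g ^+ n = 1
    & forall m : nat, (0 < m < n)%N -> g ^+ m <> 1].

Definition not_of_bounded_exponent (G : groupType) : Prop :=
  (exists g : G, infinite_order g) \/
  ~ (exists N : nat, forall (g : G) (n : nat), has_order g n -> (n <= N)%N).

Definition triple_product (G : groupType) (A : {fset G}) : {fset G} :=
  [fset p.1.1 * p.1.2 * p.2 | p in A `*` A `*` A]%fset.

(* Main.v *)
Require Import Defs.
From mathcomp Require Import all_boot all_order all_algebra finmap.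
From mathcomp Require Import boolp classical_sets functions cardinality.
From mathcomp Require Import reals exp.
From mathcomp Require Import zify ring.

(** Enlarge a finite generating set [S] of [G] by a long geometric progression
    [P = {1, g, ..., g^(m-1)}] of distinct powers; unbounded exponent supplies
    such a [g] for every [m].  The union [A] generates [G], so it is subject to
    the growth hypothesis, and it has at least [m] elements.  Its triple
    products are nevertheless few: one built from powers of [g] alone is
    [g^k] with [k < 3m], while any other one has a factor in [S], whose size
    is fixed, so that only two factors vary with [m] ([card_product3_setU]).
    Hence [|A^3| <= C m^2] with [C] depending on [S] only, and the hypothesis
    gives [c m^(1 + delta) <= C m^2] for all [m], which forces [delta <= 1]
    ([powR_growth_le]). *)

Set Implicit Arguments.
Unset Strict Implicit.
Unset Printing Implicit Defensive.

Import Order.TTheory GRing.Theory Num.Theory.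

Local Open Scope fset_scope.
Local Open Scope classical_set_scope.
Local Open Scope ring_scope.

(** With three independent factors, so that the triple products having a factor
    in a given place in [S] form a set of the same shape;
    [product3 A A A] is convertible to [triple_product A]. *)
Definition product3 (G : groupType) (A B D : {fset G}) : {fset G} :=
  ([fset p.1.1 * p.1.2 * p.2 | p in A `*` B `*` D]%g)%fset.

Lemma in_product3 (G : groupType) (A B D : {fset G}) (x : G) :
  reflect (exists a b d : G,
             [/\ a \in A, b \in B, d \in D & x = (a * b * d)%g])
          (x \in product3 A B D).
Proof.
apply: (iffP (imfsetP _ _ _ _)) => [[[[a b] d] /=]|[a [b [d [aA bB dD ->]]]]].
  rewrite !inE /= => /andP[/andP[aA bB] dD] ->.
  by exists a, b, d.
by exists (a, b, d); rewrite //= !inE /= aA bB dD.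
Qed.

Lemma card_product3_le (G : groupType) (A B D : {fset G}) :
  (#|` product3 A B D| <= #|` A| * #|` B| * #|` D|)%N.
Proof.
rewrite -2!(size_allpairs *%g); apply: uniq_leq_size (fset_uniq _) _.
move=> _ /in_product3[a [b [d [aA bB dD ->]]]].
by apply: allpairs_f dD; exact: allpairs_f.
Qed.

(** A triple of elements of [S `|` P] either avoids [S] or has its first,
    second or third factor in [S]. *)
Lemma card_product3_setU (G : groupType) (S P : {fset G}) :
  (#|` triple_product (S `|` P)%fset| <=
     #|` triple_product P| + 3 * (#|` S| * #|` (S `|` P)%fset| ^ 2))%N.
Proof.
set A := (S `|` P)%fset.
pose U := (triple_product P `|` (product3 S A A `|`
             (product3 A S A `|` product3 A A S)))%fset.
have sAU : (triple_product A `<=` U)%fset.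
  apply/fsubsetP => x /in_product3[a [b [d [aA bA dA xE]]]].
  rewrite !in_fsetU; apply/or4P.
  have [aS|aNS] := boolP (a \in S).
    by apply: Or42; apply/in_product3; exists a, b, d.
  have [bS|bNS] := boolP (b \in S).
    by apply: Or43; apply/in_product3; exists a, b, d.
  have [dS|dNS] := boolP (d \in S).
    by apply: Or44; apply/in_product3; exists a, b, d.
  apply: Or41; apply/in_product3; exists a, b, d; split=> //.
  - by move: aA; rewrite in_fsetU (negPf aNS).
  - by move: bA; rewrite in_fsetU (negPf bNS).
  - by move: dA; rewrite in_fsetU (negPf dNS).
apply: leq_trans (fsubset_leq_card sAU) _.
have cU (X Y : {fset G}) : (#|` (X `|` Y)%fset| <= #|` X| + #|` Y|)%N.
  by rewrite leq_card_fsetU.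
have := cU (triple_product P)
  (product3 S A A `|` (product3 A S A `|` product3 A A S))%fset.
have := cU (product3 S A A) (product3 A S A `|` product3 A A S)%fset.
have := cU (product3 A S A) (product3 A A S).
have := card_product3_le S A A.
have := card_product3_le A S A.
have := card_product3_le A A S.
rewrite -/U; nia.
Qed.

Definition powers (G : groupType) (g : G) (m : nat) : {fset G} :=
  ([fset (g ^+ i)%g | i in iota 0 m])%fset.

Lemma mem_powers (G : groupType) (g : G) m i :
  (i < m)%N -> (g ^+ i)%g \in powers g m.
Proof. by move=> im; apply/imfsetP; exists i; rewrite //= mem_iota. Qed.

Lemma size_enum_finmem_iota m : size (enum_finmem (mem (iota 0 m))) = m.
Proof.
rewrite -[RHS](size_iota 0 m); apply/perm_size/uniq_perm.
- exact: enum_finmem_uniq.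
- exact: iota_uniq.
- exact: enum_finmemE.
Qed.

Lemma card_powers_le (G : groupType) (g : G) m : (#|` powers g m| <= m)%N.
Proof. by rewrite -[leqRHS]size_enum_finmem_iota; exact: leq_imfset_card. Qed.

Lemma card_powers (G : groupType) (g : G) m :
  {in iota 0 m &, injective (fun i => g ^+ i)%g} -> #|` powers g m| = m.
Proof.
by move=> ginj; rewrite -[RHS]size_enum_finmem_iota; exact: card_in_imfset.
Qed.

Lemma card_triple_product_powers (G : groupType) (g : G) m :
  (#|` triple_product (powers g m)| <= 3 * m)%N.
Proof.
apply: leq_trans (card_powers_le g (3 * m)); apply: fsubset_leq_card.
apply/fsubsetP => x /in_product3[_ [_ [_ [/imfsetP[i /= im ->]
  /imfsetP[j /= jm ->] /imfsetP[k /= km ->] ->]]]].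
move: im jm km; rewrite !mem_iota -!expgnDr => im jm km.
by apply: mem_powers; lia.
Qed.

(** If two of the first [m] powers of [g] agreed, then so would [1] and
    [g ^+ n] for some [0 < n < m]. *)
Lemma powers_inj (G : groupType) (g : G) m :
  (forall n : nat, (0 < n < m)%N -> (g ^+ n)%g <> 1%g) ->
  {in iota 0 m &, injective (fun i => g ^+ i)%g}.
Proof.
move=> gn1 i j; wlog ij : i j / (i <= j)%N => [th|].
  have [ij|/ltnW ji] := leqP i j; first exact: th.
  by move=> im jm /esym gij; apply/esym/th.
rewrite !mem_iota => im jm gij.
have [//|ij'] := eqVneq i j.
case: (gn1 (j - i)%N); first by lia.
by apply: (@mulgI _ (g ^+ i)%g); rewrite -expgnDr subnKC // mulg1.
Qed.

Lemma exists_distinct_powers (G : groupType) (m : nat) :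
  not_of_bounded_exponent G -> exists g : G, #|` powers g m| = m.
Proof.
case=> [[g ginf]|unbdd].
  by exists g; apply/card_powers/powers_inj => n /andP[n0 _]; exact: ginf.
suff [g [n [mn [_ _ gn1]]]] : exists (g : G) n, (m < n)%N /\ has_order g n.
  exists g; apply/card_powers/powers_inj => k /andP[k0 km].
  by apply: gn1; rewrite k0 (ltn_trans km).
apply: contra_notP unbdd => noorder; exists m => g n gn.
by rewrite leqNgt; apply/negP => mn; apply: noorder; exists g, n.
Qed.

Lemma generated_setT_sub (G : groupType) (A B : set G) :
  A `<=` B -> generated A = [set: G] -> generated B = [set: G].
Proof.
move=> AB AT; apply/seteqP; split=> // x _.
have : generated A x by rewrite AT.
by move=> Ax H [Hsub BH]; apply: Ax; split=> //; exact: subset_trans BH.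
Qed.

(** Dividing by [m ^+ 2] leaves [m] to the power [delta - 1] bounded; if the
    exponent were positive, taking the root would bound [m] itself. *)
Lemma powR_growth_le (R : realType) (c C delta : R) : 0 < c ->
  (forall m : nat, (0 < m)%N -> c * m%:R `^ (1 + delta) <= C * m%:R ^+ 2) ->
  delta <= 1.
Proof.
move=> c0 growth; rewrite leNgt; apply/negP => delta1.
have e0 : 0 < delta - 1 by rewrite subr_gt0.
have bound m : (0 < m)%N -> m%:R `^ (delta - 1) <= C / c.
  move=> m0; have mR0 : 0 < m%:R :> R by rewrite ltr0n.
  have mE : m%:R `^ (1 + delta) = m%:R `^ (delta - 1) * m%:R ^+ 2 :> R.
    rewrite -powR_mulrn ?ltW // -powRD ?(gt_eqF mR0) ?implybT //.
    by congr (_ `^ _); ring.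
  rewrite ler_pdivlMr // -(ler_pM2r (exprn_gt0 2 mR0)) mulrAC -mE mulrC.
  exact: growth.
pose K := (C / c) `^ (delta - 1)^-1.
have bound' m : (0 < m)%N -> m%:R <= K.
  move=> m0; have := bound m m0; rewrite /K => mK.
  rewrite -[leLHS]powRr1 // -[X in _ `^ X](mulfV (lt0r_neq0 e0)) powRrM.
  apply: ge0_ler_powR => //; rewrite ?nnegrE ?powR_ge0 ?invr_ge0 ?(ltW e0) //.
  exact: le_trans (powR_ge0 _ _) mK.
have := bound' (Num.trunc K).+1 isT.
by rewrite leNgt truncnS_gt.
Qed.

Theorem proposition4p1 (R : realType) (G : groupType)
  (Gfg : finitely_generated G)
  (Ginf : infinite_set [set: G])
  (Gexp : not_of_bounded_exponent G)
  (Gnvn : ~ virtually_nilpotent [set: G])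
  (c delta : R) (c_gt0 : 0 < c) (delta_gt0 : 0 < delta)
  (Ggrowth : forall A : {fset G}, A != fset0 ->
     ~ virtually_nilpotent (generated [set` A]) ->
     c * (#|` A|%:R `^ (1 + delta)) <= #|` triple_product A|%:R) :
  delta <= 1.
Proof.
have [S Sgen] := Gfg; pose s := #|` S|.
(* [3] bounds the powers [g ^+ k], as [3 * m <= 3 * m ^ 2]; the other summand
   comes from [#|` A| <= s + m <= s.+1 * m]. *)
apply: (@powR_growth_le _ c (3 + 3 * (s * s.+1 ^ 2))%N%:R) => // m m0.
have [g gm] := exists_distinct_powers m Gexp.
pose A := (S `|` powers g m)%fset.
have mA : (m <= #|` A|)%N.
  by rewrite -[leqLHS]gm; apply/fsubset_leq_card/fsubsetUr.
have Am : (#|` A| <= s.+1 * m)%N.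
  have : (#|` A| <= s + m)%N by rewrite -gm leq_card_fsetU.
  by nia.
have Agen : generated [set` A] = [set: G].
  by apply: generated_setT_sub Sgen => x /= xS; rewrite in_fsetU xS.
have A0 : A != fset0 by rewrite -cardfs_gt0; lia.
have := Ggrowth A A0; rewrite Agen => /(_ Gnvn) grA.
apply: le_trans (le_trans _ grA) _.
  rewrite ler_pM2l // ge0_ler_powR ?nnegrE ?ler0n ?ler_nat //.
  by rewrite addr_ge0 // ltW.
rewrite -natrX -natrM ler_nat.
apply: leq_trans (card_product3_setU S (powers g m)) _.
have := card_triple_product_powers g m; rewrite -/A -/s.
have : (#|` A| ^ 2 <= (s.+1 * m) ^ 2)%N by rewrite leq_exp2r.
nia.
Qed.
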